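(* Let $G$ be a connected triangle-free graph of order $n(G)$ that has no universal vertex (no vertex adjacent to all other vertices). Then $\mu(S(G)) \ge n(G) + \mu_{it}(G)$.
   Context: All graphs are finite and simple. A universal vertex of $G$ is a vertex adjacent to every other vertex of $G$ (so the single vertex of $K_1$ is universal). The shadow graph $S(G)$ of a graph $G$ is obtained from $G$ by adding, for each vertex $v$ of $G$, a new vertex $v'$ (the shadow vertex of $v$), and joining $v'$ to all neighbours of $v$ in $G$ (shadow vertices are pairwise non-adjacent). For a vertex set $X$ of a graph $H$, two vertices $u,v$ are $X$-visible if there is a shortest $u,v$-path $P$ in $H$ with $V(P)\cap X \subseteq \{u,v\}$. The set $X$ is a mutual-visibility set if every two vertices of $X$ are $X$-visible, and a total mutual-visibility set if every two vertices of $H$ are $X$-visible. $\mu(H)$ is the maximum cardinality of a mutual-visibility set of $H$, and $\mu_{it}(H)$ is the maximum cardinality of a total mutual-visibility set of $H$ that is an independent set (it may be $0$, attained by the empty set). *)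

(* Defs.v *)
From mathcomp Require Import all_boot.
From mathcomp Require Import boolp.

Set Implicit Arguments.
Unset Strict Implicit.
Unset Printing Implicit Defensive.

Record sgraph := SGraph {
  vertex :> finType;
  adj : rel vertex;
  adj_sym : symmetric adj;
  adj_irrefl : irreflexive adj
}.

Definition connected (G : sgraph) : Prop :=
  forall u v : G, connect (@adj G) u v.

Definition triangle_free (G : sgraph) : Prop :=
  forall x y z : G, ~ [/\ adj x y, adj y z & adj z x].

Definition universal (G : sgraph) (v : G) : Prop :=
  forall u : G, u <> v -> adj v u.

Definition independent (G : sgraph) (X : {set G}) : Prop :=
  forall u v : G, u \in X -> v \in X -> ~~ adj u v.

Section Shadow.
Variable G : sgraph.

(* [inl v] is the original vertex v and [inr v] is its shadow v'. *)
Definition shadow_adj : rel (G + G)%type := fun a b =>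
  match a, b with
  | inl u, inl v => adj u v
  | inl u, inr v => adj v u
  | inr u, inl v => adj u v
  | inr _, inr _ => false
  end.

Lemma shadow_adj_sym : symmetric shadow_adj.
Proof. by move=> [u|u] [v|v] //=; rewrite adj_sym. Qed.

Lemma shadow_adj_irrefl : irreflexive shadow_adj.
Proof. by move=> [u|u] //=; rewrite adj_irrefl. Qed.

Definition shadow : sgraph := SGraph shadow_adj_sym shadow_adj_irrefl.

End Shadow.

(* The vertex sequence of the path is [u :: p]. *)
Definition is_path (G : sgraph) (u v : G) (p : seq G) : Prop :=
  [/\ path (@adj G) u p, last u p = v & uniq (u :: p)].

Definition shortest_path (G : sgraph) (u v : G) (p : seq G) : Prop :=
  is_path u v p /\ forall q : seq G, is_path u v q -> size p <= size q.

Definition visible (G : sgraph) (X : {set G}) (u v : G) : Prop :=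
  exists p : seq G, shortest_path u v p /\
    forall w : G, w \in u :: p -> w \in X -> w = u \/ w = v.

Definition mutual_visibility (G : sgraph) (X : {set G}) : Prop :=
  forall u v : G, u \in X -> v \in X -> visible X u v.

Definition total_mutual_visibility (G : sgraph) (X : {set G}) : Prop :=
  forall u v : G, visible X u v.

Definition mu (G : sgraph) : nat :=
  \max_(X : {set G} | `[< mutual_visibility X >]) #|X|.

Definition mu_it (G : sgraph) : nat :=
  \max_(X : {set G} | `[< total_mutual_visibility X /\ independent X >]) #|X|.

(* Main.v *)
(* If X is an independent total mutual-visibility set of G, then X together
   with all the shadow vertices is a mutual-visibility set of S(G).  Collapsing
   each shadow onto its original shows that distances between vertices with
   distinct originals do not shrink, so a shortest path of G avoiding X lifts to
   S(G) by changing only its ends.  The lift fails only for u, u' and for u', v'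
   with u, v adjacent; there one uses u, w, u' and u', v, w, v' respectively,
   where w is a neighbour outside X: it exists because u (or v) sees through X
   some vertex that is not adjacent to it. *)
Require Import Defs.
From mathcomp Require Import all_boot.
From mathcomp Require Import boolp.

Set Implicit Arguments.
Unset Strict Implicit.
Unset Printing Implicit Defensive.

Lemma walk_is_path (G : sgraph) (u v : G) (p : seq G) :
  path (@adj G) u p -> last u p = v -> exists2 q, is_path u v q & size q <= size p.
Proof.
move=> up <-; case/shortenP: up => q uq uniq_q sub_qp.
by exists q => //; apply: uniq_leq_size sub_qp; case/andP: uniq_q.
Qed.

Lemma shortest_path_exists (G : sgraph) (u v : G) :
  connect (@adj G) u v -> exists p, shortest_path u v p.
Proof.
case/connectP=> p0 up0 /esym/(walk_is_path up0)[p pP _].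
have exP : exists n, `[< exists2 q, is_path u v q & size q = n >].
  by exists (size p); apply/asboolP; exists p.
case: (ex_minnP exP) => n /asboolP[q qP <-] min_q.
by exists q; split=> // r rP; apply: min_q; apply/asboolP; exists r.
Qed.

Lemma visible_sym (G : sgraph) (X : {set G}) (u v : G) :
  visible X u v -> visible X v u.
Proof.
(* The vertex sequence [a :: p] read backwards has head [b] and tail [rev (belast a p)]. *)
have rev_is_path (a b : G) p : is_path a b p -> is_path b a (rev (belast a p)).
  case=> ap <- uniq_p; split.
  - rewrite rev_path -(@eq_path _ (@adj G)) // => x y; exact: adj_sym.
  - by case: p {ap uniq_p} => //= x p; rewrite rev_cons last_rcons.
  - by rewrite -rev_rcons rev_uniq -lastI.
case=> p [[pP min_p] avoid]; exists (rev (belast u p)); split; first split.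
- exact: rev_is_path.
- move=> q /rev_is_path/min_p.
  by rewrite !size_rev !size_belast.
- case: pP => _ lastp _ w.
  by rewrite -{1}lastp -rev_rcons -lastI mem_rev => wp /(avoid _ wp)[]; [right | left].
Qed.

Lemma visible_refl (G : sgraph) (X : {set G}) (u : G) : visible X u u.
Proof.
exists [::]; split; first by split.
by move=> w; rewrite inE => /eqP ->; left.
Qed.

(** Take [y] distinct from and not adjacent to [v]. On a shortest path through which [v] sees [y],
    the vertex right after [v] is neither end, so it avoids [X]. *)
Lemma total_visible_neighbour (G : sgraph) (X : {set G}) (v : G) :
  total_mutual_visibility X -> ~ universal v -> exists2 w, adj v w & w \notin X.
Proof.
move=> tX nuniv.
have [y [yv nadj]] : exists y, y <> v /\ ~~ adj v y.
  apply: contrapT => noy; apply: nuniv => u uv.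
  by apply: contrapT => /negP nvu; apply: noy; exists u.
have [[|w p] [[[vp lastp uniq_p] _] avoid]] := tX v y.
  by case: yv.
have vw : adj v w by case/andP: vp.
exists w => //; apply/negP => wX.
have wp : w \in v :: w :: p by rewrite !inE eqxx orbT.
by case: (avoid w wp wX) => ww; move: vw; rewrite ww ?adj_irrefl ?(negPf nadj).
Qed.

Definition shadow_origin (G : sgraph) (a : shadow G) : G :=
  match a with inl v => v | inr v => v end.

Definition shadow_ext (G : sgraph) (X : {set G}) : {set shadow G} :=
  [set a | if a is inl v then v \in X else true].

Lemma adj_shadow_origin (G : sgraph) (a b : shadow G) :
  adj a b -> adj (shadow_origin a) (shadow_origin b).
Proof. by case: a b => [u|u] [v|v] //=; rewrite adj_sym. Qed.

(** Collapsing shadows is a graph homomorphism, but it may identify [v] with [v']; the image is only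
    a walk, hence the inequality between lengths. *)
Lemma is_path_shadow_origin (G : sgraph) (a b : shadow G) (q : seq (shadow G)) :
  is_path a b q ->
  exists2 p, is_path (shadow_origin a) (shadow_origin b) p & size p <= size q.
Proof.
case=> aq lastq _; rewrite -(size_map (@shadow_origin G)).
apply: walk_is_path; last by rewrite last_map lastq.
by apply: homo_path aq => x y; exact: adj_shadow_origin.
Qed.

(** The lift keeps [a] and [b] as ends and takes every inner vertex as an original. An original
    inner vertex is adjacent to both copies of each neighbour, so the adjacency hypothesis matters
    only when the path is a single edge. *)
Lemma visible_shadow_ext (G : sgraph) (X : {set G}) (a b : shadow G) :
  shadow_origin a <> shadow_origin b ->
  visible X (shadow_origin a) (shadow_origin b) ->
  (adj (shadow_origin a) (shadow_origin b) -> adj a b) ->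
  visible (shadow_ext X) a b.
Proof.
move=> neq_ab [p [[pP min_p] avoid]] adj_ab.
have min_q (q : seq (shadow G)) : is_path a b q -> size p <= size q.
  by move=> /is_path_shadow_origin[r /min_p]; exact: leq_trans.
case: pP; case/lastP: p => [|p z] in avoid min_p min_q *; first by move=> _ /neq_ab.
rewrite last_rcons => path_p z_b; rewrite {z}z_b in path_p avoid min_p min_q *.
rewrite -rcons_cons rcons_uniq cons_uniq inE negb_or => /and3P[/andP[_ bp] ap uniq_p].
pose q : seq (shadow G) := map inl p.
have a_q : a \notin q.
  by apply/negP => /mapP[x xp ax]; move: ap; rewrite ax /= xp.
have b_q : b \notin q.
  by apply/negP => /mapP[x xp bx]; move: bp; rewrite bx /= xp.
exists (rcons q b); split; first split; first split.
- move: path_p; rewrite !rcons_path => /andP[path_p last_p].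
  apply/andP; split.
    rewrite /q; case: (p) path_p => //= x s /andP[ax xs]; apply/andP; split.
      by case: (a) ax.
    by rewrite path_map.
  rewrite /q; case: (p) last_p => [|x s] /=; first exact: adj_ab.
  rewrite (last_map (@inl G G)); case: (b) => //= v.
  by rewrite adj_sym.
- exact: last_rcons.
- rewrite -rcons_cons rcons_uniq inE negb_or b_q cons_uniq a_q /=.
  rewrite /q map_inj_uniq; last by move=> ? ? [].
  by rewrite uniq_p !andbT; apply/eqP => ba; apply: neq_ab; rewrite ba.
- by move=> r /min_q; rewrite !size_rcons size_map.
- move=> w; rewrite inE mem_rcons inE => /or3P[/eqP ->|/eqP ->|]; [by left|by right|].
  case/mapP=> x xp ->; rewrite inE => xX.
  have := avoid x; rewrite inE mem_rcons inE xp !orbT => /(_ isT xX)[] xE.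
    by move: ap; rewrite -xE xp.
  by move: bp; rewrite -xE xp.
Qed.

Lemma visible_own_shadow (G : sgraph) (X : {set G}) (u w : G) :
  adj u w -> w \notin X ->
  visible (shadow_ext X) (inl u : shadow G) (inr u).
Proof.
move=> uw wX; exists [:: inl w; inr u]; split; first split; first split=> //=.
- by rewrite uw.
- rewrite !inE /= andbT orbF; apply/eqP => -[uw'].
  by move: uw; rewrite uw' adj_irrefl.
- move=> [|b [|c q]] [] //=; rewrite andbT => ub bu.
  by move: ub; rewrite bu /= adj_irrefl.
- move=> z; rewrite !inE => /or3P[]/eqP-> //; [by left| |by right].
  by rewrite (negPf wX).
Qed.

Lemma visible_adj_shadows (G : sgraph) (X : {set G}) (u v w : G) :
  triangle_free G -> adj u v -> v \notin X -> adj v w -> w \notin X ->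
  visible (shadow_ext X) (inr u : shadow G) (inr v).
Proof.
move=> tf uv vX vw wX.
exists [:: inl v; inl w; inr v]; split; first split; first split=> //=.
- by rewrite uv vw.
- rewrite !inE /= andbT orbF; apply/andP; split.
    by apply/eqP => -[uv']; move: uv; rewrite uv' adj_irrefl.
  by apply/eqP => -[vw']; move: vw; rewrite vw' adj_irrefl.
- move=> [|b [|c [|d q]]] [] //=.
  + by move=> _ [vu]; move: uv; rewrite vu adj_irrefl.
  + by rewrite andbT => ub bv; move: ub; rewrite bv.
  (* A path of length 2 would have an original [b] in the middle, adjacent to both [u] and [v]: a
     triangle. *)
  + case: b => // b /and3P[ub bc _] cv; move: bc; rewrite cv /= => vb.
    by case: (tf u v b); split=> //; rewrite adj_sym.
- move=> z; rewrite !inE => /or4P[]/eqP-> //; [by left| | |by right].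
    by rewrite (negPf vX).
  by rewrite (negPf wX).
Qed.

Lemma shadow_ext_mutual_visibility (G : sgraph) (X : {set G}) :
  triangle_free G -> (forall v : G, ~ universal v) ->
  total_mutual_visibility X -> independent X ->
  mutual_visibility (shadow_ext X).
Proof.
move=> tf nuniv tX iX.
have own u : visible (shadow_ext X) (inl u : shadow G) (inr u).
  by have [w uw wX] := total_visible_neighbour tX (nuniv u); exact: visible_own_shadow uw wX.
have shadows u v : adj u v -> v \notin X ->
    visible (shadow_ext X) (inr u : shadow G) (inr v).
  move=> uv vX; have [w vw wX] := total_visible_neighbour tX (nuniv v).
  exact: visible_adj_shadows vw wX.
move=> a b _ _.
have [ab|/eqP ab] := eqVneq (shadow_origin a) (shadow_origin b).
  case: a b ab => [u|u] [v|v] /= ->; try exact: visible_refl; first exact: own.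
  by apply: visible_sym; exact: own.
(* With at least one original end, adjacency in the shadow graph agrees with adjacency of the
   origins; only two shadows remain. *)
case: a b ab => [u|u] [v|v] /= ab; try
  by apply: visible_shadow_ext => //=; rewrite adj_sym.
have [uv|nuv] := boolP (adj u v); last first.
  by apply: visible_shadow_ext => //=; rewrite (negPf nuv).
(* The path between the two shadows passes through [v]. If [v] lies in [X], independence puts [u]
   outside [X], and the roles are exchanged. *)
have [vX|] := boolP (v \in X); last exact: shadows.
apply: visible_sym; apply: shadows; first by rewrite adj_sym.
by apply/negP => uX; move: (iX u v uX vX); rewrite uv.
Qed.

Lemma card_shadow_ext (G : sgraph) (X : {set G}) :
  #|shadow_ext X| = #|G| + #|X|.
Proof.
rewrite -sum1_card big_sumType addnC -!sum1_card /=.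
by congr (_ + _); apply: eq_bigl => x; rewrite inE.
Qed.

Theorem theorem4p4 (G : sgraph) :
  connected G ->
  triangle_free G ->
  (forall v : G, ~ universal v) ->
  mu (shadow G) >= #|G| + mu_it G.
Proof.
move=> conn tf nuniv.
pose P := [pred X : {set G} | `[< total_mutual_visibility X /\ independent X >]].
have [|X /asboolP[tX iX] muX] := @eq_bigmax_cond _ P (fun X : {set G} => #|X|).
  (* The maximum is attained once some set is admissible; the empty set is, since connectedness
     provides shortest paths. *)
  apply/card_gt0P; exists set0; apply/asboolP; split.
    move=> u v; have [p pP] := shortest_path_exists (conn u v).
    by exists p; split=> // w _; rewrite inE.
  by move=> u v; rewrite inE.
rewrite /mu_it muX -card_shadow_ext.
by apply: leq_bigmax_cond; apply/asboolP; exact: shadow_ext_mutual_visibility.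
Qed.
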